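(* Let $\mathbb{F}_q$ be a finite field with $q$ elements. Let $\lambda/\mu$ be a skew partition, and let $a \in \mathbb{F}_q$. Then $$P\left(s_{\lambda/\mu} \mapsto a\right) = P\left(s_{\lambda^{t}/\mu^{t}} \mapsto a\right),$$ where $\lambda^t$ and $\mu^t$ denote the conjugate partitions of $\lambda$ and $\mu$.
   Context: A partition is a weakly decreasing finite sequence of positive integers $\lambda = (\lambda_1, \ldots, \lambda_k)$; its length is $\ell(\lambda) = k$, and one sets $\lambda_i := 0$ for $i > k$. Its Young diagram is $Y(\lambda) = \{(i,j) : 1 \leq i \leq k,\ 1 \leq j \leq \lambda_i\}$. The conjugate $\lambda^t$ is the partition whose Young diagram is $\{(j,i) : (i,j) \in Y(\lambda)\}$. A skew partition $\lambda/\mu$ is a pair of partitions with $\mu_i \leq \lambda_i$ for all $i \geq 1$. Let $\mathcal{P} = \mathbb{Z}[h_1, h_2, h_3, \ldots]$ be the polynomial ring, with $h_0 := 1$ and $h_m := 0$ for $m < 0$. For a skew partition $\lambda/\mu$ with $k = \ell(\lambda)$, the skew Schur function is $s_{\lambda/\mu} := \det\left( h_{\lambda_i - \mu_j - i + j} \right)_{1 \leq i,j \leq k} \in \mathcal{P}$. For $f \in \mathcal{P}$ and $a \in \mathbb{F}_q$, choose $N$ such that $f$ involves only $h_1, \ldots, h_N$; then $$P(f \mapsto a) := \frac{\#\{(z_1, \ldots, z_N) \in \mathbb{F}_q^N \mid f(z_1, \ldots, z_N) = a\}}{q^N},$$ where the integer coefficients of $f$ are mapped to $\mathbb{F}_q$.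 This does not depend on the choice of $N$. *)

(* Defs.v *)
From HB Require Import structures.
From mathcomp Require Import all_boot all_order all_algebra finmap.
From mathcomp.multinomials Require Import monalg.

Set Implicit Arguments.
Unset Strict Implicit.
Unset Printing Implicit Defensive.

Import Order.TTheory GRing.Theory Num.Theory.

Local Open Scope nat_scope.

Definition is_intpart (s : seq nat) : bool := sorted geq s && (0 \notin s).

Record intpart := IntPart { parts :> seq nat; _ : is_intpart parts }.

HB.instance Definition _ := [isSub for parts].

(* Rows, columns and parts are numbered from 0: [part la i] is the
   mathematical la_(i+1), and it vanishes for i >= size la. *)
Definition part (la : intpart) (i : nat) : nat := nth 0 la i.

Definition young (la : intpart) : pred (nat * nat) :=
  [pred c | (c.1 < size la) && (c.2 < part la c.1)].

Definition skew_partition (la mu : intpart) : Prop :=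
  forall i, part mu i <= part la i.

(* Part j is the height of column j of the diagram; the number of nonempty
   columns is the largest part. [young_conj] and [young_inj] show that this is
   the one partition whose diagram is the transpose. *)
Definition conj_seq (s : seq nat) : seq nat :=
  [seq count (fun p => j < p) s | j <- iota 0 (head 0 s)].

Lemma conj_seqP (la : intpart) : is_intpart (conj_seq la).
Proof.
case: la => s /= /andP[s_sorted s0]; apply/andP; split.
  apply: (homo_sorted (e := leq)); last exact: iota_sorted.
  by move=> i j le_ij /=; apply: sub_count => p /=; apply: leq_ltn_trans.
apply/mapP => -[j]; rewrite mem_iota add0n /= => lt_j.
by case: s lt_j {s_sorted s0} => //= x s ->.
Qed.

Definition conj (la : intpart) : intpart := IntPart (conj_seqP la).

Lemma part_ltE (la : intpart) i j :
  (j < part la i) = (i < count (fun p => j < p) la).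
Proof.
rewrite /part; case: la => s /= /andP[+ _].
elim: s i => [|x s IHs] i s_sorted; first by rewrite nth_nil.
have s_sorted' := path_sorted s_sorted.
have geq_trans : transitive geq by move=> b a c ab bc; apply: leq_trans bc ab.
have allx : all (geq x) s by apply: order_path_min s_sorted.
case: i => [|i] /=; last first.
  rewrite IHs //; case: (ltnP j x) => [_|le_xj]; first by rewrite add1n.
  rewrite add0n.
  suff -> : count (fun p => j < p) s = 0 by [].
  apply/eqP; rewrite -leqn0 leqNgt -has_count; apply/hasPn => p /(allP allx) /=.
  by move=> le_px; rewrite -leqNgt (leq_trans le_px).
case: (ltnP j x) => //= le_xj; rewrite add0n; apply/esym/negbTE.
rewrite -has_count; apply/hasPn => p /(allP allx) /= le_px.
by rewrite -leqNgt (leq_trans le_px).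
Qed.

Lemma youngE (la : intpart) c : young la c = (c.2 < part la c.1).
Proof.
rewrite /young /=; case: (ltnP c.1 (size la)) => //= le_la.
by rewrite /part nth_default.
Qed.

Lemma young_conj (la : intpart) i j : young (conj la) (j, i) = young la (i, j).
Proof.
rewrite !youngE /= [RHS]part_ltE /part /= /conj_seq.
case: (ltnP j (head 0 la)) => lt_j.
  by rewrite (nth_map 0) ?size_iota // nth_iota.
rewrite nth_default ?size_map ?size_iota // ltn0; apply/esym/negbTE.
rewrite -part_ltE -leqNgt (leq_trans _ lt_j) // leqNgt part_ltE.
by rewrite -leqNgt (leq_trans _ (leq0n i)) // leqNgt -part_ltE /part nth0 ltnn.
Qed.

Lemma young_inj (la mu : intpart) : young la =1 young mu -> la = mu.
Proof.
move=> eq_lm.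
have eq_part i : part la i = part mu i.
  have lt_part j : (j < part la i) = (j < part mu i).
    by have := eq_lm (i, j); rewrite !youngE.
  apply/anti_leq/andP; split; rewrite leqNgt; apply/negP.
    by rewrite lt_part ltnn.
  by rewrite -lt_part ltnn.
have size_part (nu : intpart) i : (i < size nu) = (0 < part nu i).
  case: (ltnP i (size nu)) => lt_i; last by rewrite /part nth_default.
  have /andP[_ nu0] := valP nu; rewrite /part lt0n; apply/esym.
  by apply: contraNN nu0 => /eqP <-; apply: mem_nth.
apply: val_inj; apply: (@eq_from_nth _ 0) => [|i _]; last exact: eq_part.
apply/anti_leq/andP; split; rewrite leqNgt; apply/negP.
  by rewrite size_part eq_part -size_part ltnn.
by rewrite size_part -eq_part -size_part ltnn.
Qed.

Local Open Scope ring_scope.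

(* The polynomial ring Z[h_1, h_2, ...]; the generator of index i : nat
   is h_(i+1). *)
Notation hpoly := {malg int[{cmonom nat}]}.

Definition hgen (m : int) : hpoly :=
  match m with
  | Posz 0 => 1
  | Posz n.+1 => << ucm n >>
  | Negz _ => 0
  end.

Definition skew_schur (la mu : intpart) : hpoly :=
  \det (\matrix_(i < size la, j < size la)
          hgen ((part la i)%:Z - (part mu j)%:Z - i%:Z + j%:Z)).

Definition involves_only (N : nat) (f : hpoly) : Prop :=
  forall m, m \in msupp f -> forall i, i \in finsupp m -> (i < N)%N.

Definition nvars (f : hpoly) : nat :=
  \max_(m <- msupp f) \max_(i <- finsupp m) i.+1.

(* f(z_1, ..., z_N), with integer coefficients mapped to F; only meant for f
   with [involves_only N f]. *)
Definition heval (F : finFieldType) (N : nat) (z : {ffun 'I_N -> F})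
    (f : hpoly) : F :=
  mmap intr (fun m : {cmonom nat} => \prod_(i < N) z i ^+ m i) f.

Definition prob_in (F : finFieldType) (N : nat) (f : hpoly) (a : F) : rat :=
  #|[set z : {ffun 'I_N -> F} | heval z f == a]|%:R / (#|F| ^ N)%:R.

(* [nvars f] is the least admissible N; by [probE] any other one gives the
   same value. *)
Definition prob (F : finFieldType) (f : hpoly) (a : F) : rat :=
  prob_in (nvars f) f a.

Lemma involves_onlyE N f : involves_only N f <-> (nvars f <= N)%N.
Proof.
split=> [fN | le_fN m mf i im].
  by apply/bigmax_leqP_seq => m mf _; apply/bigmax_leqP_seq => i im _; apply: fN im.
apply: leq_trans le_fN; rewrite /nvars.
apply: leq_trans (leq_bigmax_seq _ mf isT).
exact: (leq_bigmax_seq i im isT).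
Qed.

Lemma prob_inS (F : finFieldType) N f (a : F) :
  involves_only N f -> prob_in N.+1 f a = prob_in N f a.
Proof.
move=> fN; rewrite /prob_in.
pose r (z : {ffun 'I_N.+1 -> F}) := [ffun i : 'I_N => z (lift ord_max i)].
have evalr z : heval z f = heval (r z) f.
  rewrite /heval !mmapE; apply: eq_big_seq => m mf; congr (_ * _).
  rewrite big_ord_recr /= [m N](_ : _ = 0%N) ?expr0 ?mulr1; last first.
    by apply: fsfun_dflt; apply/negP => /(fN m mf); rewrite ltnn.
  apply: eq_bigr => i _; rewrite ffunE; congr (z _ ^+ _).
  by apply: val_inj; rewrite /= /bump leqNgt ltn_ord.
pose g (p : {ffun 'I_N -> F} * F) : {ffun 'I_N.+1 -> F} :=
  [ffun i => if unlift ord_max i is Some j then p.1 j else p.2].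
have rg p : r (g p) = p.1 by apply/ffunP => i; rewrite !ffunE liftK.
have gm p : g p ord_max = p.2 by rewrite ffunE unlift_none.
have g_inj : injective g.
  move=> p p' eq_g; apply: injective_projections.
    by rewrite -rg eq_g rg.
  by rewrite -gm eq_g gm.
have -> : [set z | heval z f == a] =
          g @: setX [set z | heval z f == a] [set: F].
  apply/setP => z; rewrite inE; apply/idP/imsetP => [za | [p + ->]].
    exists (r z, z ord_max); first by rewrite !inE -evalr za.
    apply/ffunP => i; rewrite ffunE; case: unliftP => [j ->|-> //].
    by rewrite ffunE.
  by rewrite !inE andbT evalr rg.
have F0 : #|F|%:R != 0 :> rat.
  by rewrite pnatr_eq0 -lt0n; apply/card_gt0P; exists 0.
rewrite card_imset // cardsX cardsT expnSr !natrM -mulf_div.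
by rewrite divff // mulr1.
Qed.

Lemma probE (F : finFieldType) N f (a : F) :
  involves_only N f -> prob f a = prob_in N f a.
Proof.
move=> /involves_onlyE /subnKC <-; rewrite /prob.
elim: (N - nvars f)%N => [|n IHn]; first by rewrite addn0.
by rewrite addnS prob_inS //; apply/involves_onlyE; rewrite leq_addr.
Qed.

(* Main.v *)
(* The substitution h_m |-> e_m, where E(-X) H(X) = 1, is an involution of the
   truncated series over F_q, hence permutes F_q^N. It exchanges s_{la/mu} with
   s_{la^t/mu^t}: the two determinants are complementary minors of the mutually
   inverse Toeplitz matrices of H(X) and E(-X), because the integers
   la_i + k - i (1 <= i <= k) and k - 1 + j - la^t_j (1 <= j <= m) partition
   {0, ..., k + m - 1}. *)
Require Import Defs.
From HB Require Import structures.
From mathcomp Require Import all_boot all_order all_algebra.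
From mathcomp Require Import fingroup perm finmap zify.
From mathcomp.multinomials Require Import monalg.

Set Implicit Arguments.
Unset Strict Implicit.
Unset Printing Implicit Defensive.

Import Order.TTheory GRing.Theory Num.Theory.

(* The Maya diagram of f in a k x m box: the induction removes the first row,
   whose bead at f 0 + k - 1 is put back by [lift_perm]. *)
Lemma maya_perm k m (f : nat -> nat) :
    (forall i, f i.+1 <= f i) -> f 0 <= m ->
  exists s : 'S_(k + m),
    [/\ forall i : 'I_k, s (lshift m i) = f i + (k - i.+1) :> nat,
        forall j : 'I_m, s (rshift k j) + \sum_(i < k) (j < f i) = k + j :> nat
      & odd_perm s = odd (\sum_(i < k) s (lshift m i))].
Proof.
elim: k f => [|k IHk] f f_decr f0m.
  exists 1%g; split=> [[] //|j|]; last by rewrite big_ord0 odd_perm1.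
  by rewrite perm1 big_ord0 addn0.
have [s [sl sr so]] :=
  IHk (f \o S) (fun i => f_decr i.+1) (leq_trans (f_decr 0) f0m).
have f_le i : f i <= f 0 by elim: i => // i IHi; apply: leq_trans IHi.
have lt0 : f 0 + k < (k + m).+1 by rewrite ltnS addnC leq_add2l.
pose x := Ordinal lt0.
have lt_sl (i : 'I_k) : s (lshift m i) < f 0 + k.
  by rewrite sl /=; have := f_le i.+1; have := ltn_ord i; lia.
exists (lift_perm ord0 x s); split.
- move=> i; case: (@unliftP k.+1 ord0 i) => [/= i1 ->|->].
    rewrite (_ : @lshift k.+1 m _ =
                 lift ord0 (lshift m i1 : 'I_(k + m)) :> 'I_(k + m).+1);
      last exact: val_inj.
    by rewrite lift_perm_lift /= /bump leqNgt lt_sl /= sl.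
  rewrite (_ : @lshift k.+1 m _ = ord0 :> 'I_(k + m).+1); last exact: val_inj.
  by rewrite lift_perm_id /= subn1.
- move=> j.
  rewrite (_ : @rshift k.+1 m _ = lift ord0 (rshift k j) :> 'I_(k + m).+1);
    last exact: val_inj.
  rewrite lift_perm_lift big_ord_recl /= /bump.
  rewrite (_ : \sum_(i < k) _ = \sum_(i < k) (j < (f \o S) i));
    last exact: eq_bigr.
  (* If j >= f 0, no row reaches column j, so the old value k + j is at or above the new bead and
     shifts by one; otherwise it stays put and row 0 adds one to the count. *)
  have := sr j; set c := \sum_(i < k) _.
  have c0 : f 0 <= j -> c = 0.
    move=> le_j; apply: big1 => i _; rewrite ltnNge.
    by rewrite (leq_trans (f_le i.+1) le_j).
  case: (ltnP j (f 0)) => [lt_j|/[dup] /c0 -> le_j]; last first.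
    by rewrite addn0 => ->; rewrite [f 0 + k]addnC leq_add2l le_j; lia.
  move=> sr_j; have -> : (f 0 + k <= s (rshift k j)) = false by lia.
  by rewrite add0n addnCA sr_j.
- rewrite odd_lift_perm so big_ord_recl oddD; congr (odd _ (+) odd _).
    rewrite (_ : @lshift k.+1 m _ = ord0 :> 'I_(k + m).+1); last exact: val_inj.
    by rewrite lift_perm_id.
  apply: eq_bigr => i _.
  rewrite (_ : @lshift k.+1 m _ = lift ord0 (lshift m i) :> 'I_(k + m).+1).
    by rewrite lift_perm_lift /= /bump leqNgt lt_sl.
  exact: val_inj.
Qed.

(** * Parts of a conjugate partition *)

Lemma part_decr (la : intpart) i : part la i.+1 <= part la i.
Proof.
rewrite leqNgt; apply/negP; rewrite part_ltE => /ltnW.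
by rewrite -part_ltE ltnn.
Qed.

Lemma part_conjE (la : intpart) j : part (conj la) j = count (ltn j) la.
Proof.
have lt_part i : (i < part (conj la) j) = (i < count (ltn j) la).
  by have := young_conj la i j; rewrite !youngE [RHS]part_ltE.
apply/anti_leq/andP; split; rewrite leqNgt; apply/negP.
  by rewrite lt_part ltnn.
by rewrite -lt_part ltnn.
Qed.

(** Rows longer than j come first ([part_ltE]), so stopping at k rows loses none. This turns the
    count in [maya_perm] into a conjugate part. *)
Lemma sum_part_conj (la : intpart) k j :
  size la <= k -> \sum_(i < k) (j < part la i) = part (conj la) j.
Proof.
move=> le_k; rewrite part_conjE.
under eq_bigr do rewrite part_ltE.
have sum_minn n c : \sum_(i < n) (i < c) = minn n c.
  by elim: n => [|n IHn]; rewrite ?big_ord0 ?big_ord_recr /= ?IHn; lia.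
by rewrite sum_minn; apply/minn_idPr/(leq_trans _ le_k)/count_size.
Qed.

Lemma part_le_size_conj (la : intpart) i : part la i <= size (conj la).
Proof.
rewrite size_map size_iota -nth0 -/(part la 0).
by elim: i => // i; apply/leq_trans/part_decr.
Qed.

Lemma skew_partition_size (la mu : intpart) :
  skew_partition la mu -> size mu <= size la.
Proof.
move=> lamu; rewrite leqNgt; apply/negP => lt_la.
have := lamu (size la); rewrite [part la _]nth_default // leqn0 => /eqP mu_0.
by have /andP[_ /negP[]] := valP mu; rewrite -mu_0; apply: mem_nth.
Qed.

Local Open Scope ring_scope.

(** * Power series modulo X^N *)

Section TruncatedSeries.
Variable R : comNzRingType.
Implicit Types p q r : {poly R}.

Definition eq_upto N p q := forall n, (n < N)%N -> p`_n = q`_n.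

Lemma eq_uptoM N p p' q q' :
  eq_upto N p p' -> eq_upto N q q' -> eq_upto N (p * q) (p' * q').
Proof.
move=> eqp eqq n ltn; rewrite !coefM; apply: eq_bigr => i _.
rewrite eqp ?eqq //; first exact: leq_ltn_trans (leq_subr _ _) ltn.
by apply: leq_trans ltn; rewrite ltnS -ltnS.
Qed.

Lemma eq_upto_inv_uniq N p q q' :
  eq_upto N (p * q) 1 -> eq_upto N (p * q') 1 -> eq_upto N q q'.
Proof.
move=> pq pq' n ltn.
have refl (s : {poly R}) : eq_upto N s s by [].
have := eq_uptoM pq' (refl q) ltn.
by rewrite mul1r mulrAC (eq_uptoM pq (refl q') ltn) mul1r.
Qed.

(** Geometric series of 1 / (1 - (1 - p)), cut off at N terms. *)
Definition series_inv N p : {poly R} := \sum_(i < N) (1 - p) ^+ i.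

(** The product telescopes to 1 - (1 - p)^N, and X divides 1 - p because p has constant term 1. *)
Lemma series_invP N p : p`_0 = 1 -> eq_upto N (p * series_inv N p) 1.
Proof.
move=> p0 n ltn.
have -> : p * series_inv N p = 1 - (1 - p) ^+ N.
  have := subrX1 (1 - p) N.
  rewrite -/(series_inv N p) addrAC subrr add0r mulNr => /(canLR opprK) <-.
  by rewrite opprB.
have -> : 1 - p = drop_poly 1 (1 - p) * 'X^1.
  rewrite -[LHS](poly_take_drop 1) [take_poly _ _](_ : _ = 0) ?add0r //.
  apply/polyP => i; rewrite coef_take_poly coef0; case: i => //=.
  by rewrite coefB coef1 p0 subrr.
by rewrite exprMn -exprM mul1n coefB coefMXn ltn subr0.
Qed.

Lemma coef_comp_polyNX p n : (p \Po - 'X)`_n = (-1) ^+ n * p`_n.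
Proof.
rewrite comp_polyE coef_sum.
under eq_bigr => i _ do
  rewrite exprNn -[1]/(1%:P : {poly R}) -polyCN -polyC_exp coefZ coefCM coefXn.
case: (ltnP n (size p)) => [lt_n | le_n]; last first.
  rewrite nth_default // mulr0 big1 // => i _.
  by rewrite (gtn_eqF (leq_trans (ltn_ord i) le_n)) !mulr0.
rewrite (bigD1 (Ordinal lt_n)) //= eqxx mulr1 mulrC big1 ?addr0 // => i ne_i.
rewrite [n == i](_ : _ = false) ?mulr0 //.
by apply: contraNF ne_i => /eqP eq_ni; apply/eqP/val_inj.
Qed.
End TruncatedSeries.

(** * Complementary minors and Toeplitz matrices *)

(** Jacobi's identity: give B the first block column of the identity. Multiplied by A, it yields the
    first block column of A next to the second of the identity; take determinants. *)
Lemma det_jacobi_block (R : comNzRingType) k m (A B : 'M[R]_(k + m)) :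
  A *m B = 1%:M -> \det (ulsubmx A) = \det A * \det (drsubmx B).
Proof.
move=> AB1.
have /(congr1 determinant) :
    A *m block_mx 1%:M (ursubmx B) 0 (drsubmx B) =
    block_mx (ulsubmx A) 0 (dlsubmx A) 1%:M.
  rewrite -{1}[A]submxK mulmx_block !mulmx0 !mulmx1 !addr0.
  have := AB1; rewrite -{1}[A]submxK -{1}[B]submxK mulmx_block.
  by rewrite scalar_mx_block => /eq_block_mx[_ -> _ ->].
by rewrite det_mulmx det_ublock det_lblock !det1 mul1r mulr1 => ->.
Qed.

Definition toeplitz_mx (R : pzSemiRingType) M (p : nat -> R) : 'M[R]_M :=
  \matrix_(i, j) if (i <= j)%N then p (j - i)%N else 0.

Lemma toeplitz_mxM (R : nzSemiRingType) M (p q : {poly R}) :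
  toeplitz_mx M (nth 0 p) *m toeplitz_mx M (nth 0 q) =
  toeplitz_mx M (nth 0 (p * q)).
Proof.
apply/matrixP => i j; rewrite !mxE.
under eq_bigr do rewrite !mxE.
rewrite -(big_mkord xpredT (fun l => (if (i <= l)%N then p`_(l - i) else 0) *
  (if (l <= j)%N then q`_(j - l) else 0))).
(* Only i <= l <= j contributes, which leaves the Cauchy product for coefficient j - i. *)
rewrite (big_cat_nat (leq0n i) (ltnW (ltn_ord i))) /=.
rewrite [X in X + _]big_nat_cond big1 ?add0r; last first.
  by move=> l /andP[/andP[_ lt_li] _]; rewrite leqNgt lt_li mul0r.
case: leqP => [le_ij | lt_ji]; last first.
  rewrite big_nat_cond big1 // => l /andP[/andP[le_il _] _].
  by rewrite [(l <= j)%N]leqNgt (leq_trans lt_ji le_il) mulr0.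
rewrite (big_cat_nat (leqW le_ij) (ltn_ord j)) /=.
rewrite [X in _ + X]big_nat_cond [X in _ + X]big1 ?addr0; last first.
  by move=> l /andP[/andP[lt_jl _] _]; rewrite [(l <= j)%N]leqNgt lt_jl mulr0.
rewrite coefM -{1}[i : nat]add0n big_addn subSn // big_mkord.
apply: eq_bigr => l _; rewrite leq_addl addnK.
have -> : (l + i <= j)%N by have := ltn_ord l; lia.
by rewrite subnDA subnAC.
Qed.

Lemma det_toeplitz (R : comNzRingType) M (p : nat -> R) :
  p 0%N = 1 -> \det (toeplitz_mx M p) = 1.
Proof.
move=> p0; rewrite -det_tr det_trig.
  by rewrite big1 // => i _; rewrite !mxE leqnn subnn.
by apply/is_trig_mxP => i j lt_ij; rewrite !mxE leqNgt lt_ij.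
Qed.

(** The zero at negative indices matches h_m = 0 for m < 0. *)
Definition coefz (R : nzRingType) (p : {poly R}) (n : int) : R :=
  if n is Posz n' then p`_n' else 0.

Lemma coefzB (R : nzRingType) (p : {poly R}) (a b : nat) :
  coefz p (b%:Z - a%:Z) = if (a <= b)%N then p`_(b - a) else 0.
Proof.
case: leqP => [le_ab | lt_ba]; first by rewrite subzn.
by rewrite -opprB subzn ?(ltnW lt_ba) // -(prednK (_ : 0 < a - b)%N) ?subn_gt0.
Qed.

(** The images of the first block give the sign of s; with those of the second they exhaust all x <
    k + m. The result is independent of s, so two such factors cancel. *)
Lemma sign_shuffle (R : comNzRingType) k m (s : 'S_(k + m)) :
    odd_perm s = odd (\sum_(i < k) s (lshift m i)) ->
  (-1) ^+ s * \prod_(j < m) (-1) ^+ s (rshift k j) =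
    (-1) ^+ (\sum_(x < k + m) x) :> R.
Proof.
move=> ->; rewrite signr_odd prodrXr -exprD (reindex_inj (@perm_inj _ s)) /=.
by rewrite big_split_ord.
Qed.

Lemma dual_jacobi_trudi (R : comNzRingType) (la mu : intpart) (p q : {poly R}) :
    skew_partition la mu -> p`_0 = 1 ->
    eq_upto (size la + size (conj la)) (p * q) 1 ->
  \det (\matrix_(i < size la, j < size la)
          coefz p ((part la i)%:Z - (part mu j)%:Z - i%:Z + j%:Z)) =
  \det (\matrix_(i < size (conj la), j < size (conj la))
          coefz (q \Po - 'X)
            ((part (conj la) i)%:Z - (part (conj mu) j)%:Z - i%:Z + j%:Z)).
Proof.
move=> lamu p0 pq1; have := skew_partition_size lamu.
have := part_le_size_conj la 0.
move: pq1; set m := size (conj la); set k := size la => pq1 le_la0 le_muk.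
have [s [sl sr so]] := maya_perm k (part_decr la) le_la0.
(* Zero parts pad mu to k rows, so both diagrams sit in the same k x m box. *)
have [t [tl tr t_o]] :=
  maya_perm k (part_decr mu) (leq_trans (lamu 0%N) le_la0).
pose A := toeplitz_mx (k + m) (nth 0 p).
pose B := toeplitz_mx (k + m) (nth 0 q).
have AB1 : A *m B = 1%:M.
  rewrite toeplitz_mxM; apply/matrixP => i j; rewrite !mxE.
  case: leqP => [le_ij | lt_ji]; last by rewrite -val_eqE (gtn_eqF lt_ji).
  rewrite pq1 ?coef1; first by rewrite subn_eq0 -val_eqE /= eqn_leq le_ij.
  exact: leq_ltn_trans (leq_subr _ _) (ltn_ord j).
(* The upper left block gets entries p_(s j - t i), the transpose of the matrix for la/mu. B is
   permuted the inverse way, so the product stays 1. *)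
have := @det_jacobi_block _ k m
  (row_perm t (col_perm s A)) (row_perm s (col_perm t B)).
have -> : row_perm t (col_perm s A) *m row_perm s (col_perm t B) = 1%:M.
  rewrite !row_permE !col_permE !mulmxA -[_ *m perm_mx s^-1 *m _]mulmxA.
  rewrite -perm_mxM mulVg perm_mx1 mulmx1 -[_ *m A *m B]mulmxA AB1 mulmx1.
  by rewrite -perm_mxM mulgV perm_mx1.
move=> /(_ erefl).
set X := \det (ulsubmx _); set Y := \det (drsubmx _).
rewrite row_permE col_permE !det_mulmx !det_perm odd_permV det_toeplitz //.
rewrite mul1r => XY.
have <- : X = \det (\matrix_(i < k, j < k)
    coefz p ((part la i)%:Z - (part mu j)%:Z - i%:Z + j%:Z)).
  rewrite /X -det_tr; congr determinant; apply/matrixP => i j; rewrite !mxE.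
  rewrite -(coefzB p) sl tl; congr coefz.
  by have := ltn_ord i; have := ltn_ord j; lia.
set Z := \det _.
(* Substituting -X for X puts the sign (-1)^(t j - s i) on each entry; it splits into a row sign and
   a column sign, that is, two diagonal factors. *)
have YZ : Y = \prod_(i < m) (-1) ^+ s (rshift k i) * Z *
              \prod_(j < m) (-1) ^+ t (rshift k j).
  pose d (u : 'S_(k + m)) : 'rV[R]_m := \row_i (-1) ^+ u (rshift k i).
  have det_d u : \det (diag_mx (d u)) = \prod_i (-1) ^+ u (rshift k i).
    by rewrite det_diag; apply: eq_bigr => i _; rewrite mxE.
  rewrite -!det_d -!det_mulmx; congr determinant; apply/matrixP => i j.
  rewrite mul_diag_mx mul_mx_diag !mxE.
  have -> : (part (conj la) i)%:Z - (part (conj mu) j)%:Z - i%:Z + j%:Z =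
      (t (rshift k j))%:Z - (s (rshift k i))%:Z.
    have := sr i; have := tr j; rewrite !sum_part_conj //; lia.
  rewrite coefzB; case: leqP => [le_st | _]; last by rewrite !(mulr0, mul0r).
  rewrite coef_comp_polyNX mulrA -exprD (subnKC le_st) mulrAC -exprD.
  by rewrite -signr_odd oddD addbb mul1r.
have -> : X = ((-1) ^+ t * \prod_(j < m) (-1) ^+ t (rshift k j)) *
    ((-1) ^+ s * \prod_(j < m) (-1) ^+ s (rshift k j)) * Z.
  rewrite XY YZ [in RHS]mulrACA -[RHS]mulrA.
  by congr (_ * _); rewrite mulrC mulrA.
by rewrite !sign_shuffle // -exprD -signr_odd oddD addbb mul1r.
Qed.

(** * Evaluation as a ring morphism *)

(** Named to carry the multiplicativity that makes [heval] a ring morphism, which then passes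
    through determinants. *)
Definition monom_eval (F : finFieldType) N (z : {ffun 'I_N -> F})
  (m : {cmonom nat}) : F := \prod_(i < N) z i ^+ m i.

Lemma monom_eval_mmorphism (F : finFieldType) N (z : {ffun 'I_N -> F}) :
  mmorphism (monom_eval z).
Proof.
split=> [m1 m2|]; last by rewrite /monom_eval big1 // => i _; rewrite cm1.
by rewrite -big_split; apply: eq_bigr => i _; rewrite cmM exprD.
Qed.

HB.instance Definition _ (F : finFieldType) N (z : {ffun 'I_N -> F}) :=
  isMultiplicative.Build _ _ (monom_eval z) (monom_eval_mmorphism z).

Lemma heval_det (F : finFieldType) N (z : {ffun 'I_N -> F}) n
    (A : 'M[hpoly]_n) :
  heval z (\det A) = \det (\matrix_(i, j) heval z (A i j)).
Proof.
rewrite -[LHS]/(mmap intr (monom_eval z) (\det A)) -det_map_mx.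
by congr determinant; apply/matrixP => i j; rewrite !mxE.
Qed.

Lemma heval_hgenS (F : finFieldType) N (z : {ffun 'I_N -> F}) (i : 'I_N) :
  heval z (hgen i.+1) = z i.
Proof.
rewrite -[LHS]/(mmap intr (monom_eval z) _) mmapU mul1r /monom_eval.
rewrite (bigD1 i) //=.
rewrite cmUU expr1 big1 ?mulr1 // => j ne_ji; rewrite cmU.
by rewrite eq_sym [_ == _ :> nat](negbTE ne_ji) expr0.
Qed.

(** * The involution exchanging h and e *)

Section HtoE.
Variables (F : finFieldType) (N : nat).
Implicit Types z : {ffun 'I_N -> F}.

Definition hseries z : {poly F} := 1 + \sum_(i < N) z i *: 'X^(i.+1).

Lemma hseries0 z : (hseries z)`_0 = 1.
Proof.
rewrite coefD coef1 coef_sum big1 ?addr0 // => i _.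
by rewrite coefZ coefXn mulr0.
Qed.

Lemma hseriesS z (i : 'I_N) : (hseries z)`_i.+1 = z i.
Proof.
rewrite coefD coef1 add0r coef_sum (bigD1 i) //= coefZ coefXn eqxx mulr1.
rewrite big1 ?addr0 // => j ne_ji; rewrite coefZ coefXn eqSS.
by rewrite eq_sym [_ == _ :> nat](negbTE ne_ji) mulr0.
Qed.

(* For n > N the left-hand side is the junk value 1: [heval] drops the
   variables of index >= N. *)
Lemma heval_hgen z (n : int) : (n <= N%:Z)%R ->
  heval z (hgen n) = coefz (hseries z) n.
Proof.
case: n => [[|n]|n] /= le_n.
- by rewrite hseries0; apply: (rmorph1 (mmap intr (monom_eval z))).
- by rewrite -[n]/(nat_of_ord (Ordinal (le_n : n < N)%N)) heval_hgenS hseriesS.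
- exact: (raddf0 (mmap intr (monom_eval z))).
Qed.

(* Coordinate i is e_(i+1), as E(X) = 1 / H(-X). *)
Definition h_to_e z : {ffun 'I_N -> F} :=
  [ffun i : 'I_N => (series_inv N.+1 (hseries z) \Po - 'X)`_i.+1].

(** The coordinates of [h_to_e z] record only degrees 1 to N; in degree 0, the inverse of a series
    with constant term 1 again has constant term 1. *)
Lemma hseries_h_to_e z :
  eq_upto N.+1 (hseries (h_to_e z)) (series_inv N.+1 (hseries z) \Po - 'X).
Proof.
case=> [|i] lt_i.
  rewrite hseries0 coef_comp_polyNX mul1r.
  have := series_invP (hseries0 z) (isT : 0 < N.+1)%N.
  by rewrite coefM big_ord1 hseries0 mul1r coef1 => ->.
by rewrite -[i.+1]/((Ordinal (lt_i : i < N)%N).+1) hseriesS ffunE.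
Qed.

Lemma eq_upto_comp_polyNX M (p q : {poly F}) :
  eq_upto M p q -> eq_upto M (p \Po - 'X) (q \Po - 'X).
Proof. by move=> pq n lt_n; rewrite !coef_comp_polyNX pq. Qed.

(** From E(X) H(-X) = 1, uniqueness of inverses gives 1 / E(X) = H(-X) modulo X^(N+1), and
    substituting -X returns H(X). *)
Lemma h_to_eK : involutive h_to_e.
Proof.
move=> z; apply/ffunP => i; rewrite ffunE -hseriesS.
set p := hseries z; set p' := hseries (h_to_e z).
have p'p : eq_upto N.+1 (p' * (p \Po - 'X)) 1.
  move=> n lt_n.
  rewrite (eq_uptoM (hseries_h_to_e z) (fun _ _ => erefl) lt_n).
  rewrite -comp_polyM mulrC -[1](comp_polyC 1 (- 'X)).
  exact: eq_upto_comp_polyNX (series_invP (hseries0 z)) _ lt_n.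
have lt_i : (i.+1 < N.+1)%N by rewrite ltnS.
have inv_p' := eq_upto_inv_uniq (series_invP (hseries0 (h_to_e z))) p'p.
rewrite (eq_upto_comp_polyNX inv_p' lt_i) !coef_comp_polyNX mulrA -exprD.
by rewrite -signr_odd oddD addbb mul1r.
Qed.
End HtoE.

(** * Evaluated skew Schur functions and the count *)

(** The bound on N keeps every index la_i - mu_j - i + j at most N, away from the junk values of
    [heval_hgen]. *)
Lemma heval_skew_schur (F : finFieldType) N (z : {ffun 'I_N -> F})
    (la mu : intpart) :
    (size la + size (conj la) <= N)%N ->
  heval z (skew_schur la mu) = \det (\matrix_(i < size la, j < size la)
    coefz (hseries z) ((part la i)%:Z - (part mu j)%:Z - i%:Z + j%:Z)).
Proof.
move=> leN; rewrite heval_det; congr determinant; apply/matrixP => i j.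
rewrite !mxE heval_hgen //.
by have := part_le_size_conj la i; have := ltn_ord j; lia.
Qed.

Lemma size_conj_conj (la : intpart) : size (conj (conj la)) = size la.
Proof.
have -> // : conj (conj la) = la.
by apply: young_inj => -[i j]; rewrite !young_conj.
Qed.

Lemma coefz_eq_upto (R : comNzRingType) M (p q : {poly R}) (n : int) :
  eq_upto M p q -> (n < M%:Z)%R -> coefz p n = coefz q n.
Proof. by case: n => //= n pq lt_n; apply: pq. Qed.

Lemma heval_h_to_e (F : finFieldType) N (z : {ffun 'I_N -> F})
    (la mu : intpart) :
    skew_partition la mu -> (size la + size (conj la) <= N)%N ->
  heval z (skew_schur la mu) =
  heval (h_to_e z) (skew_schur (conj la) (conj mu)).
Proof.
move=> lamu leN.
rewrite !heval_skew_schur ?size_conj_conj 1?[(size (conj la) + _)%N]addnC //.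
(* This inverse is valid modulo X^(N+1), which covers the [size la + size (conj la)] coefficients
   required. *)
rewrite (@dual_jacobi_trudi _ _ _ _ (series_inv N.+1 (hseries z))) ?hseries0 //.
  congr determinant; apply/matrixP => i j; rewrite !mxE.
  apply/esym/(coefz_eq_upto (@hseries_h_to_e _ _ z)).
  have := part_le_size_conj (conj la) i; have := ltn_ord j.
  by rewrite size_conj_conj; lia.
move=> n lt_n; apply: series_invP (hseries0 z) _ _.
exact: leq_trans lt_n (leqW leN).
Qed.

Theorem theorem4p1 (F : finFieldType) (la mu : intpart)
    (lamu : skew_partition la mu) (a : F) :
  prob (skew_schur la mu) a = prob (skew_schur (conj la) (conj mu)) a.
Proof.
pose f := skew_schur la mu; pose g := skew_schur (conj la) (conj mu).
(* N is admissible for both polynomials and large enough for [heval_h_to_e]. *)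
pose N := maxn (size la + size (conj la)) (maxn (nvars f) (nvars g)).
rewrite (@probE _ N) -/f; last first.
  by apply/involves_onlyE; rewrite !leq_max leqnn !orbT.
rewrite (@probE _ N) -/g; last first.
  by apply/involves_onlyE; rewrite !leq_max leqnn !orbT.
(* The involution is injective, so the right-hand solution set has as many points as its preimage,
   which is the left-hand one. *)
rewrite /prob_in -[in RHS](card_preimset _ (inv_inj (@h_to_eK F N))).
congr (_%:R / _); apply: eq_card => z; rewrite !inE (heval_h_to_e _ lamu) //.
exact: leq_maxl.
Qed.
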